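(* Let $G$ be the $(n\times n)$-grid. Then for every $Q\subseteq V_1$, with $p=|Q|$, it holds that $\delta(Q)\ge\min(\delta(Z_p),\delta(Z'_p))$.
   Context: The $(n\times n)$-grid $G$ has vertex set $\{(x,y): x,y\in\mathbb Z,\ 1\le x,y\le n\}$, with $(x,y)$ adjacent to $(x',y')$ iff $|x-x'|+|y-y'|=1$. $V_1=\{(x,y): x+y \text{ even}\}$. For $S\subseteq V(G)$, $N(S)=\bigcup_{v\in S}N(v)\setminus S$ and $\delta(S)=|N(S)|$. For an integer $i$, $U_i=\{(x,y)\in V(G):x+y=i\}$ and $W_i=\{(x,y)\in V(G):x-y=i\}$. Let $v_1,\ldots,v_{\lceil n^2/2\rceil}$ be the ordering of $V_1$ that lists consecutively the vertices of $U_2,U_4,\ldots,U_{2n}$, the vertices within each $U_i$ listed in increasing order of $y$-coordinate; $Z_p=\{v_1,\ldots,v_p\}$. Let $v'_1,\ldots,v'_{\lceil n^2/2\rceil}$ be the ordering of $V_1$ that lists consecutively the vertices of $W_{2\lceil n/2\rceil-2},W_{2\lceil n/2\rceil-4},\ldots,W_{2-2\lceil n/2\rceil}$, the vertices within each $W_i$ listed in increasing order of $y$-coordinate; $Z'_p=\{v'_1,\ldots,v'_p\}$ (with $Z_0=Z'_0=\emptyset$). *)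

(* Defs.v *)
From mathcomp Require Import all_boot all_order all_algebra.

Set Implicit Arguments.
Unset Strict Implicit.
Unset Printing Implicit Defensive.

Section Neighbourhood.
Variables (T : finType) (e : rel T).
Implicit Types (v : T) (S : {set T}).

Definition nbhd v : {set T} := [set w | e v w].

Definition Nbhd S : {set T} := (\bigcup_(v in S) nbhd v) :\: S.

Definition delta S : nat := #|Nbhd S|.

End Neighbourhood.

Definition grid (n : nat) : finType := ('I_n * 'I_n)%type.

Section Grid.
Variable n : nat.
Implicit Types (u v w : grid n) (p : nat).

(* Coordinates range over 1..n, whereas the elements of 'I_n are 0..n-1. *)
Definition xc v : nat := v.1.+1.
Definition yc v : nat := v.2.+1.

(* `|a - b|%N is the integer distance, not truncated subtraction. *)
Definition grid_adj : rel (grid n) :=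
  fun u v => (`|xc u - xc v| + `|yc u - yc v|)%N == 1%N.

Definition V1 : {set grid n} := [set v | ~~ odd (xc v + yc v)].

Definition U (i : nat) : {set grid n} := [set v | xc v + yc v == i].

Definition W (i : int) : {set grid n} :=
  [set v | ((xc v)%:Z - (yc v)%:Z)%R == i].

(* Only used on the sets U i and W i, on which yc is injective, so that
   the listing is determined by the set. *)
Definition by_y (S : {set grid n}) : seq (grid n) :=
  sort (fun u v => yc u <= yc v) (enum S).

(* U_2, U_4, ..., U_{2n} *)
Definition order_U : seq (grid n) :=
  flatten [seq by_y (U (2 * k)) | k <- iota 1 n].

(* W_{2c-2}, W_{2c-4}, ..., W_{2-2c} with c = uphalf n = ceil(n/2);
   there are 2c-1 of them (none if n = 0). *)
Definition order_W : seq (grid n) :=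
  flatten [seq by_y (W ((2 * uphalf n)%:Z - 2%:Z - (2 * k)%:Z)%R)
          | k <- iota 0 (2 * uphalf n - 1)].

Definition Z p : {set grid n} := [set v in take p order_U].

Definition Z' p : {set grid n} := [set v in take p order_W].

End Grid.

(* Main.v *)
(* Write N(S) for the union of the neighbourhoods of the points of S, and number
   rows and columns from 0 to m = n - 1. Pushing Q down along each line x - y = c,
   or along each line x + y = c, keeps |Q| and does not increase |N(Q)|, and it
   lowers the sum of the y-coordinates unless Q is fixed. So Q may be assumed
   closed under (x, y) -> (x - 1, y - 1) and (x, y) -> (x + 1, y - 1). Row i + 1
   of N(Q) is then row i of Q, whence |N(Q)| = |Q| + |N(R_0)| - |R_m|, where R_i
   is row i of Q and N(R_0) is taken in the path with n vertices. Two rows up, a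
   row that is neither empty nor full has lost at least one point. If R_0 is not
   full, then R_m is empty and this gives |Q| <= |N(R_0)|^2, which makes Z_p
   optimal. If R_0 is full, the same argument applied to V_1 \ Q, upside down,
   bounds |V_1 \ Q| by k^2 (n odd) or k (k + 1) (n even), where k is the number of
   points missing from R_m, and Z_p (n odd) or Z'_p (n even) is optimal. *)

Require Import Defs.
From mathcomp Require Import all_boot.
From mathcomp Require Import ssralg ssrint zify.

Set Implicit Arguments.
Unset Strict Implicit.
Unset Printing Implicit Defensive.

(** * Counting in finite sets *)

Section FiniteSets.
Variable T : finType.

Lemma card_leq_bound (A : {set T}) (f : T -> nat) t :
  {in A &, injective f} -> {in A, forall x, f x < t} -> #|A| <= t.
Proof.
move=> finj fA; rewrite cardE -(size_iota 0 t) -(size_map f).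
apply: uniq_leq_size.
  by rewrite map_inj_in_uniq ?enum_uniq // => x y; rewrite !mem_enum; apply: finj.
by move=> _ /mapP[x xA ->]; rewrite mem_iota /= add0n fA // -mem_enum.
Qed.

Lemma card_inj_leq (I : finType) (S : {set T}) (f : I -> T) :
  injective f -> (forall i, f i \in S) -> #|I| <= #|S|.
Proof.
move=> finj fS; rewrite -cardsT -(card_imset _ finj).
by apply/subset_leq_card/subsetP => _ /imsetP[i _ ->].
Qed.

Lemma card_inj_lt (I : finType) (S : {set T}) (f : I -> T) v :
  injective f -> (forall i, f i \in S) -> v \in S -> (forall i, f i != v) ->
  #|I| < #|S|.
Proof.
move=> finj fS vS fv; rewrite (cardsD1 v S) vS add1n ltnS.
by apply: (card_inj_leq finj) => i; rewrite !inE fv fS.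
Qed.

Lemma card_fibers (J : finType) (key : T -> J) (S : {set T}) :
  #|S| = \sum_j #|S :&: [set v | key v == j]|.
Proof.
rewrite -sum1_card (partition_big key xpredT) //=; apply: eq_bigr => j _.
by rewrite -sum1_card; apply: eq_bigl => v; rewrite !inE.
Qed.

Lemma sum_fibers (J : finType) (key : T -> J) (Y : J -> nat) (S : {set T}) :
  \sum_(v in S) Y (key v) = \sum_j #|S :&: [set v | key v == j]| * Y j.
Proof.
rewrite (partition_big key xpredT) //=; apply: eq_bigr => j _.
rewrite -sum_nat_const; apply: eq_big => [v|v /andP[_ /eqP->] //].
by rewrite !inE.
Qed.

(** [A :\: B] and [B :\: A] have equally many points in each fibre, and there [Y] separates the
    values of [h]: below it on the first, at least it on the second. This gives the strict drop of
    the potential under compression. *)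
Lemma sum_lt_fibers (J : finType) (key : T -> J) (h : T -> nat) (Y : J -> nat)
    (A B : {set T}) :
  (forall j, #|A :&: [set v | key v == j]| = #|B :&: [set v | key v == j]|) ->
  {in A, forall v, h v < Y (key v)} ->
  {in B :\: A, forall v, Y (key v) <= h v} ->
  A != B -> \sum_(v in A) h v < \sum_(v in B) h v.
Proof.
move=> cAB hA hB neqAB.
have cDE j : #|(A :\: B) :&: [set v | key v == j]|
           = #|(B :\: A) :&: [set v | key v == j]|.
  set K := [set v | key v == j].
  have := cardsID B (A :&: K); have := cardsID A (B :&: K).
  rewrite !setIDAC -/K (cAB j : #|A :&: K| = #|B :&: K|).
  by rewrite -!setIA (setIC K B) (setIC K A) !setIA (setIC A B); lia.
have cAB0 : #|A| = #|B|.
  by rewrite !(card_fibers key); apply: eq_bigr => j _; apply: cAB.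
have DA0 : 0 < #|A :\: B|.
  rewrite card_gt0; apply: contraNneq neqAB => /eqP; rewrite setD_eq0 => AB.
  by rewrite eqEcard AB cAB0 /=.
rewrite (big_setID B) [X in _ < X](big_setID A) /= setIC ltn_add2l.
apply: (@leq_trans (\sum_(v in A :\: B) Y (key v))); last first.
  rewrite sum_fibers (eq_bigr _ (fun j _ => congr1 (muln^~ _) (cDE j))).
  by rewrite -sum_fibers; apply: leq_sum.
apply: (@leq_trans (\sum_(v in A :\: B) (h v + 1))).
  by rewrite big_split /= sum1_card -addn1 leq_add2l.
by apply: leq_sum => v /setDP[vA _]; rewrite addn1 hA.
Qed.

End FiniteSets.

(** * Counting on intervals of naturals *)

Section Intervals.
Implicit Types P : pred nat.

Definition cnt P l := count P (iota 0 l).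

Lemma cntS P l : cnt P l.+1 = cnt P l + P l.
Proof. by rewrite /cnt -addn1 iotaD count_cat /= add0n addn0. Qed.

Lemma cnt_leq P l : cnt P l <= l.
Proof. by rewrite -[leqRHS](size_iota 0) count_size. Qed.

Lemma cnt_lt a l : cnt (fun i => i < a) l = minn a l.
Proof. by elim: l => [|l IH]; rewrite ?minn0 // cntS IH; lia. Qed.

(** The successor of the last element of [P] is a gain. This is the passage to a longer adjacent
    diagonal. *)
Lemma cnt_expand P P' l :
  (forall i, i < l -> P i -> P' i && P' i.+1) ->
  0 < cnt P l -> cnt P l < cnt P' l.+1.
Proof.
elim: l => // l IH PP'; rewrite cntS [cnt P' _]cntS => c0.
have PP'l i : i < l -> P i -> P' i && P' i.+1 by move=> il; apply: PP'; lia.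
have := PP' l (ltnSn l); case: (P l) c0 => /=; last first.
  by move=> c0 _; move: (IH PP'l); lia.
move=> _ /(_ isT)/andP[Pl ->]; rewrite cntS Pl.
by have := IH PP'l; rewrite cntS Pl; lia.
Qed.

(** This is the passage to a shorter adjacent diagonal. Elements of [P] before a gap are kept in
    place and those after it move back by one; if [P] has no gap, [P'] is everything. *)
Lemma cnt_shrink P P' l :
  (forall i, i <= l -> P i -> ((i < l) ==> P' i) && ((0 < i) ==> P' i.-1)) ->
  minn (cnt P l.+1) l <= cnt P' l.
Proof.
move=> PP'; suff : (l <= cnt P' l) || (cnt P l.+1 <= cnt P' l) by lia.
elim: l PP' => [//|l IH] PP'.
have /IH : forall i, i <= l -> P i -> ((i < l) ==> P' i) && ((0 < i) ==> P' i.-1).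
  by move=> i il Pi; have := PP' i ltac:(lia) Pi; lia.
have := PP' l.+1 (leqnn _); have := PP' l (leqnSn _).
have := cnt_leq P l.
rewrite (cntS P l.+1) (cntS P l) (cntS P' l) /= ltnSn ltnn /=.
by case: (P l); case: (P l.+1); case: (P' l) => /=; lia.
Qed.

End Intervals.

(** * Compression along diagonals *)

Section Grid.
Variable m : nat.
Local Notation n := m.+1.
Implicit Types (u v : grid n) (Q S : {set grid n}).

Definition opennb S : {set grid n} := \bigcup_(v in S) nbhd (@grid_adj n) v.

Lemma grid_adjE u v : grid_adj u v =
  [|| (u.1 == v.1 :> nat) && ((u.2 == v.2.+1 :> nat) || (v.2 == u.2.+1 :> nat)) |
      (u.2 == v.2 :> nat) && ((u.1 == v.1.+1 :> nat) || (v.1 == u.1.+1 :> nat))].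
Proof. by rewrite /grid_adj /xc /yc; lia. Qed.

Lemma mem_opennb S v :
  reflect (exists2 u, u \in S & grid_adj u v) (v \in opennb S).
Proof.
by apply: (iffP bigcupP) => -[u uS]; rewrite ?inE => uv; exists u; rewrite ?inE.
Qed.

Lemma delta_leq_opennb S : delta (@grid_adj n) S <= #|opennb S|.
Proof. by apply/subset_leq_card/subsetDl. Qed.

Lemma V1E v : (v \in V1 n) = ~~ odd (v.1 + v.2).
Proof. by rewrite inE /xc /yc; lia. Qed.

Lemma delta_opennb S : S \subset V1 n -> delta (@grid_adj n) S = #|opennb S|.
Proof.
move=> /subsetP SV; rewrite /delta /Nbhd -/(opennb S).
have -> : opennb S :\: S = opennb S; last by [].
apply/setDidPl; rewrite disjoints_subset; apply/subsetP => v /mem_opennb[u uS].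
rewrite inE grid_adjE => uv; apply/negP => /SV; move: (SV _ uS); rewrite !V1E.
by move: uv; lia.
Qed.

Lemma gridP u v : reflect (u.1 = v.1 :> nat /\ u.2 = v.2 :> nat) (u == v).
Proof.
apply: (iffP eqP) => [-> //|[]]; case: u v => [a b] [c d] /= ac bd.
by congr (_, _); apply: val_inj.
Qed.

Section Compression.

(* The diagonal x - y = d - m carries the index d; its points, listed by
   increasing y, are [pt d 0, ..., pt d (len d).-1]. The truncated
   subtractions make [pt] cover both sides of the main diagonal. *)
Definition dg v := v.1 + (m - v.2).
Definition rk v := minn v.1 v.2.
Definition pt d i : grid n := (inord (i + (d - m)), inord (i + (m - d))).
Definition len d := n - (d - m) - (m - d).
Definition line S d : {set grid n} := S :&: [set v | dg v == d].

Lemma pt_val d i : i < len d ->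
  (pt d i).1 = i + (d - m) :> nat /\ (pt d i).2 = i + (m - d) :> nat.
Proof. by rewrite /len => h; rewrite /pt /= !inordK; [split|lia|lia]. Qed.

Lemma pt_dgrk v : v = pt (dg v) (rk v).
Proof.
apply/eqP/gridP; case: v => [[x hx] [y hy]]; rewrite /pt /dg /rk /= !inordK; [split| |].
  all: by lia.
Qed.

Lemma y_rk v : v.2 = rk v + (m - dg v) :> nat.
Proof. by case: v => [[x hx] [y hy]]; rewrite /rk /dg /=; lia. Qed.

Lemma rk_len v : rk v < len (dg v).
Proof. by rewrite /rk /len /dg; have := ltn_ord v.1; have := ltn_ord v.2; lia. Qed.

Lemma dg_pt d i : d <= m.*2 -> i < len d -> dg (pt d i) = d.
Proof. by move=> dm il; have [h1 h2] := pt_val il; rewrite /dg h1 h2; move: il;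
  rewrite /len; lia. Qed.

Lemma rk_pt d i : i < len d -> rk (pt d i) = i.
Proof. by move=> il; have [h1 h2] := pt_val il; rewrite /rk h1 h2; lia. Qed.

Lemma dg_bound v : dg v <= m.*2.
Proof. by rewrite /dg; have := ltn_ord v.1; have := ltn_ord v.2; lia. Qed.

Lemma rk_inj S d : {in line S d &, injective rk}.
Proof.
move=> u v; rewrite !inE => /andP[_ /eqP du] /andP[_ /eqP dv] ruv.
by rewrite (pt_dgrk u) (pt_dgrk v) du dv ruv.
Qed.

Lemma card_line S d : d <= m.*2 ->
  #|line S d| = cnt (fun i => pt d i \in S) (len d).
Proof.
move=> dm; rewrite /cnt -size_filter -(size_map (pt d)); apply/eqP.
rewrite cardE eqn_leq !uniq_leq_size ?enum_uniq //.
- rewrite map_inj_in_uniq ?filter_uniq ?iota_uniq // => i j.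
  rewrite !mem_filter !mem_iota !add0n => /and3P[_ _ il] /and3P[_ _ jl].
  by move=> eqp; rewrite -(rk_pt il) eqp rk_pt.
- move=> v /mapP[i]; rewrite mem_filter mem_iota add0n => /and3P[iS _ il] ->.
  by rewrite mem_enum !inE iS dg_pt //=.
- move=> v; rewrite mem_enum !inE => /andP[vS /eqP <-]; apply/mapP; exists (rk v).
    by rewrite mem_filter mem_iota -pt_dgrk vS add0n rk_len.
  exact: pt_dgrk.
Qed.

Definition compress Q := [set v | rk v < #|line Q (dg v)|].

Lemma line_empty S d : m.*2 < d -> #|line S d| = 0.
Proof.
move=> dm; apply/eqP; rewrite cards_eq0 -subset0; apply/subsetP => v.
by rewrite !inE => /andP[_ /eqP dv]; move: (dg_bound v); lia.
Qed.

Lemma card_line_compress Q d : #|line (compress Q) d| = #|line Q d|.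
Proof.
have [dm|dm] := leqP d m.*2; last by rewrite !line_empty.
rewrite card_line //.
transitivity (cnt (fun i => i < #|line Q d|) (len d)).
  apply: eq_in_count => i; rewrite mem_iota add0n => /andP[_ il].
  by rewrite inE rk_pt // dg_pt.
by rewrite cnt_lt; apply/minn_idPl; rewrite card_line ?cnt_leq.
Qed.

Lemma dgo_subproof v : dg v < m.*2.+1. Proof. by rewrite ltnS dg_bound. Qed.
Definition dgo v : 'I_m.*2.+1 := Ordinal (dgo_subproof v).

Lemma line_dgo S (d : 'I_m.*2.+1) : line S d = S :&: [set v | dgo v == d].
Proof. by apply/setP => v; rewrite !inE. Qed.

Lemma card_compress Q : #|compress Q| = #|Q|.
Proof.
rewrite !(card_fibers dgo); apply: eq_bigr => d _.
by rewrite -!line_dgo card_line_compress.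
Qed.

Lemma compress_dg Q v : v \in compress Q -> exists2 u, u \in Q & dg u = dg v.
Proof.
rewrite inE => lt_rk; have /card_gt0P[u] : 0 < #|line Q (dg v)| by lia.
by rewrite !inE => /andP[uQ /eqP]; exists u.
Qed.

Lemma adj_dg u v : grid_adj u v ->
  (dg v = (dg u).+1 \/ dg u = (dg v).+1) /\ (rk v <= (rk u).+1).
Proof.
case: u v => [[x hx] [y hy]] [[x' hx'] [y' hy']].
rewrite grid_adjE /dg /rk /=.
by case/orP => /andP[/eqP ?] /orP[/eqP ?|/eqP ?]; subst; lia.
Qed.

(** Diagonals shorten away from the main one. A step in that direction raises a largest coordinate
    or lowers the other one, so the minimum [rk] does not grow. *)
Lemma adj_line u v : grid_adj u v ->
  len (dg v) = (len (dg u)).+1 \/ len (dg u) = (len (dg v)).+1 /\ rk v <= rk u.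
Proof.
move=> uv; have [[]] := adj_dg uv; move: uv.
  case: u v => [[x hx] [y hy]] [[x' hx'] [y' hy']].
  rewrite grid_adjE /len /dg /rk /= => uv dguv _; rewrite dguv.
  have [xy|xy] := leqP y x; last by left; lia.
  right; split; first by lia.
  by case/orP: uv => /andP[/eqP ?] /orP[/eqP ?|/eqP ?]; subst; lia.
case: u v => [[x hx] [y hy]] [[x' hx'] [y' hy']].
rewrite grid_adjE /len /dg /rk /= => uv dguv _; rewrite dguv.
have [xy|xy] := leqP x y; last by left; lia.
right; split; first by lia.
by case/orP: uv => /andP[/eqP ?] /orP[/eqP ?|/eqP ?]; subst; lia.
Qed.

Lemma adj_pt d e i j : e = d.+1 \/ d = e.+1 -> i < len d -> j < len e ->
  [\/ j = i, len d < len e /\ j = i.+1 | len e < len d /\ i = j.+1] ->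
  grid_adj (pt d i) (pt e j).
Proof.
move=> de il jl ij; rewrite grid_adjE.
have [-> ->] := pt_val il; have [-> ->] := pt_val jl; move: ij il jl.
rewrite /len; case: de => ->.
  have [dm|dm] := leqP m d.
    rewrite (_ : m - d = 0) 1?(_ : m - d.+1 = 0); try lia.
    by case=> [|[]|[]]; lia.
  rewrite (_ : d - m = 0) 1?(_ : d.+1 - m = 0); try lia.
  by case=> [|[]|[]]; lia.
have [dm|dm] := leqP m e.
  rewrite (_ : m - e = 0) 1?(_ : m - e.+1 = 0); try lia.
  by case=> [|[]|[]]; lia.
rewrite (_ : e - m = 0) 1?(_ : e.+1 - m = 0); try lia.
by case=> [|[]|[]]; lia.
Qed.

(** The heart of the compression: as ranks are distinct on a diagonal, bounding the rank of each new
    neighbour bounds their number. If [Q] has c points on the diagonal of [u], [opennb Q] has at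
    least c + 1 on a longer adjacent diagonal, and at least c, or all points, on a shorter one. *)
Lemma rk_opennb_compress Q u v : u \in compress Q -> grid_adj u v ->
  rk v < #|line (opennb Q) (dg v)|.
Proof.
rewrite inE => ruQ uv; have [de rr] := adj_dg uv.
rewrite !card_line ?dg_bound // in ruQ *.
have nbQ i j : pt (dg u) i \in Q -> i < len (dg u) -> j < len (dg v) ->
    [\/ j = i, len (dg u) < len (dg v) /\ j = i.+1
      | len (dg v) < len (dg u) /\ i = j.+1] ->
    pt (dg v) j \in opennb Q.
  by move=> iQ il jl ij; apply/mem_opennb; exists (pt (dg u) i) => //; apply: adj_pt.
have rlv := rk_len v; move: ruQ nbQ rlv {de}.
have [->|[-> rr']] := adj_line uv => ruQ nbQ rlv.
  apply: (leq_ltn_trans rr); apply: (leq_ltn_trans ruQ); apply: cnt_expand.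
    move=> i il iQ; apply/andP.
    by split; apply: (nbQ i) => //; try lia; [apply: Or31|apply: Or32].
  exact: leq_trans ruQ.
apply: leq_trans (cnt_shrink _).
  by rewrite leq_min rlv andbT; exact: leq_ltn_trans ruQ.
move=> i il iQ; apply/andP; split; apply/implyP => ?.
  by apply: (nbQ i) => //; apply: Or31.
by apply: (nbQ i) => //; [lia|apply: Or33; lia].
Qed.

Lemma opennb_compress Q : #|opennb (compress Q)| <= #|opennb Q|.
Proof.
rewrite !(card_fibers dgo); apply: leq_sum => d _; rewrite -!line_dgo.
apply: (card_leq_bound (@rk_inj _ _)) => v; rewrite !inE => /andP[].
by move=> /mem_opennb[u uQ uv] /eqP <-; apply: rk_opennb_compress uv.
Qed.

Lemma sum_y_compress Q : compress Q != Q ->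
  \sum_(v in compress Q) v.2 < \sum_(v in Q) v.2.
Proof.
apply: (@sum_lt_fibers _ _ dgo (fun v => v.2) (fun d => #|line Q d| + (m - d))).
- by move=> d; rewrite -!line_dgo card_line_compress.
- by move=> v; rewrite inE /= => rv; rewrite y_rk; lia.
- by move=> v; rewrite !inE -leqNgt => /andP[rv _]; rewrite y_rk leq_add2r.
Qed.

(** * Reflection and reduction to down-closed sets *)

Definition reflect_x v : grid n := (rev_ord v.1, v.2).

Lemma reflect_xK : involutive reflect_x.
Proof. by move=> [x y]; rewrite /reflect_x /= rev_ordK. Qed.

Definition reflect_x_inj := inv_inj reflect_xK.

Lemma reflect_x_adj u v : grid_adj (reflect_x u) (reflect_x v) = grid_adj u v.
Proof.
case: u v => [[x hx] [y hy]] [[x' hx'] [y' hy']].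
by rewrite !grid_adjE /=; lia.
Qed.

Lemma mem_reflect_x S v : (v \in reflect_x @: S) = (reflect_x v \in S).
Proof. by rewrite -{1}(reflect_xK v) (mem_imset _ _ reflect_x_inj). Qed.

Lemma opennb_reflect_x S : opennb (reflect_x @: S) = reflect_x @: opennb S.
Proof.
apply/setP => v; rewrite mem_reflect_x; apply/mem_opennb/mem_opennb.
  by move=> [u]; rewrite mem_reflect_x => uS uv; exists (reflect_x u);
    rewrite ?reflect_x_adj.
move=> [u uS uv]; exists (reflect_x u); rewrite ?mem_reflect_x ?reflect_xK //.
by rewrite -reflect_x_adj reflect_xK.
Qed.

Lemma dg_odd u v : dg u = dg v -> odd (u.1 + u.2) = odd (v.1 + v.2).
Proof.
by case: u v => [[x hx] [y hy]] [[x' hx'] [y' hy']]; rewrite /dg /=; lia.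
Qed.

(** The index [dg (reflect_x u)] is 2m - (x + y). For even n the reflection exchanges the two
    colours, so parity is compared at the unreflected points. *)
Lemma dg_reflect_x_odd u v : dg (reflect_x u) = dg (reflect_x v) ->
  odd (u.1 + u.2) = odd (v.1 + v.2).
Proof.
by case: u v => [[x hx] [y hy]] [[x' hx'] [y' hy']]; rewrite /dg /=; lia.
Qed.

Lemma compress_down Q u v : v \in compress Q ->
  v.2 = u.2.+1 :> nat -> v.1 = u.1.+1 :> nat -> u \in compress Q.
Proof.
rewrite !inE => rv v2 v1.
have [<- rk_uv] : dg v = dg u /\ rk u < rk v; last exact: leq_trans (ltnW _) rv.
case: u v v1 v2 {rv} => [[x hx] [y hy]] [[x' hx'] [y' hy']] /=.
by rewrite /dg /rk /=; lia.
Qed.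

Definition down_closed S := forall u v, v \in S -> v.2 = u.2.+1 :> nat ->
  u.1 = v.1.+1 :> nat \/ v.1 = u.1.+1 :> nat -> u \in S.

Lemma exists_down_closed Q : Q \subset V1 n -> exists D : {set grid n},
  [/\ D \subset V1 n, #|D| = #|Q|, #|opennb D| <= #|opennb Q| & down_closed D].
Proof.
have [k] := ubnP (\sum_(v in Q) v.2); elim: k Q => // k IH Q; rewrite ltnS => sk QV.
have sV : {in Q, forall v, ~~ odd (v.1 + v.2)}.
  by move=> v /(subsetP QV); rewrite V1E.
have [e1|/sum_y_compress lt1] := eqVneq (compress Q) Q; last first.
  have [||D [D1 D2 D3 D4]] := IH (compress Q); first exact: leq_trans lt1 sk.
    by apply/subsetP => v /compress_dg[u /sV]; rewrite V1E => + /dg_odd <-.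
  exists D; split; rewrite // ?D2 ?card_compress //.
  exact: leq_trans D3 (opennb_compress Q).
pose R := reflect_x @: Q.
have sR S : \sum_(v in reflect_x @: S) v.2 = \sum_(v in S) v.2.
  by rewrite big_imset //; move=> ? ? _ _; apply: reflect_x_inj.
have cR S : #|reflect_x @: S| = #|S| by apply: card_imset reflect_x_inj.
have [e2|/sum_y_compress lt2] := eqVneq (compress R) R; last first.
  have [||D [D1 D2 D3 D4]] := IH (reflect_x @: compress R).
  - by rewrite sR; apply: leq_trans lt2 _; rewrite sR.
  - apply/subsetP => v; rewrite mem_reflect_x => /compress_dg[u].
    rewrite mem_reflect_x => /sV; rewrite V1E => + duv.
    by rewrite (@dg_reflect_x_odd _ v) // reflect_xK.
  exists D; split; rewrite // ?D2 ?cR ?card_compress ?cR //.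
  apply: leq_trans D3 _; rewrite opennb_reflect_x cR.
  by apply: leq_trans (opennb_compress R) _; rewrite opennb_reflect_x cR.
exists Q; split=> // u v vQ uv2 [uv1|uv1]; last first.
  by rewrite -e1; apply: (compress_down _ uv2 uv1); rewrite e1.
rewrite -(reflect_xK u) -mem_reflect_x -/R -e2.
apply: (@compress_down _ _ (reflect_x v)) => //=; last first.
  by rewrite uv1 !subSS subnSK // -ltnS -uv1 ltn_ord.
by rewrite e2 mem_reflect_x reflect_xK.
Qed.

End Compression.

End Grid.

(** Even and odd indices give two sequences that drop by at least one until they reach 0, so each
    sum is at most a triangular number. In the induction [s 2] is replaced by [s 0 - 1], and adding
    2 [s 0] restores the bound. *)
Lemma sum_two_step_bound (s : nat -> nat) N :
  (forall i, i.+2 < N -> s i.+2 <= (s i).-1) ->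
  2 * \sum_(i < N) s i <= s 0 * (s 0).+1 + s 1 * (s 1).+1.
Proof.
elim: N s => [|k IH] s sS; first by rewrite big_ord0.
have := IH (fun i => s i.+1) (fun i => sS i.+1).
have tri a : 2 * a <= a * a.+1 by case: a => // a; nia.
rewrite big_ord_recl; case: k {IH} sS => [|[|k]] sS.
- by rewrite big_ord0 /= => _; have := tri (s 0); lia.
- rewrite !big_ord_recl big_ord0 /= => _.
  by have := tri (s 0); have := tri (s 1); lia.
have := sS 0 isT; rewrite /= (eq_bigr (fun i : 'I_k.+2 => s i.+1)) //.
move: (\sum_(i < _) _) => S.
by move: (s 0) (s 1) (s 2) => [|a] b c /= ? ?; nia.
Qed.

(** * Neighbourhoods in a path *)

Section Path.
Variable m : nat.
Local Notation n := m.+1.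
Implicit Types (x z : 'I_n) (R : {set 'I_n}) (b : bool).

Definition nb1 R : {set 'I_n} :=
  [set x : 'I_n | [exists z in R, (x == z.+1 :> nat) || (z == x.+1 :> nat)]].

Definition class b : {set 'I_n} := [set x : 'I_n | odd x == b].

Lemma nb1P R x :
  reflect (exists2 z, z \in R & x = z.+1 :> nat \/ z = x.+1 :> nat) (x \in nb1 R).
Proof.
rewrite inE; apply: (iffP exists_inP) => -[z zR xz]; exists z => //.
  by case/orP: xz => /eqP; [left|right].
by case: xz => ->; rewrite eqxx ?orbT.
Qed.

Lemma nb1S R1 R2 : R1 \subset R2 -> nb1 R1 \subset nb1 R2.
Proof.
by move=> /subsetP sR; apply/subsetP => x /nb1P[z /sR zR xz]; apply/nb1P; exists z.
Qed.

Lemma nb1_class R b : R \subset class b -> nb1 R \subset class (~~ b).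
Proof.
move=> /subsetP sR; apply/subsetP => x /nb1P[z /sR]; rewrite !inE => /eqP <-.
by case=> ->; rewrite /= ?negbK.
Qed.

Lemma exists_nb x : 0 < m -> exists z, x = z.+1 :> nat \/ z = x.+1 :> nat.
Proof.
move=> m0; have [x0|x0] := posnP x.
  by exists (inord 1); right; rewrite inordK ?x0.
have := ltn_ord x => xn.
by exists (inord x.-1); left; rewrite inordK; lia.
Qed.

Lemma sub_nb1_nb1 R : 0 < m -> R \subset nb1 (nb1 R).
Proof.
move=> m0; apply/subsetP => x xR; have [z xz] := exists_nb x m0.
apply/nb1P; exists z => //; apply/nb1P; exists x => //.
by case: xz => ->; [right|left].
Qed.

Lemma nb1_full b : 0 < m -> class (~~ b) \subset nb1 (class b).
Proof.
move=> m0; apply/subsetP => x; rewrite inE => /eqP xb.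
have [z xz] := exists_nb x m0; apply/nb1P; exists z => //.
by rewrite inE; apply/eqP; case: xz xb => ->; case: b; rewrite /=; case: odd.
Qed.

(** A nonempty part of a parity class that is closed under steps of two is the whole class. The
    truncated predecessor covers the empty set. *)
Lemma card_nb1_nb1 R b : 0 < m -> R \subset class b -> R != class b ->
  #|R| <= #|nb1 (nb1 R)|.-1.
Proof.
move=> m0 sRb nRb; have [->|/set0Pn[x0 x0R]] := eqVneq R set0.
  by rewrite cards0.
suff : R \proper nb1 (nb1 R) by move/proper_card; lia.
rewrite properE sub_nb1_nb1 //=; apply: contra nRb => /subsetP sR.
rewrite eqEsubset sRb; apply/subsetP => x xb.
(* Induction on the distance |x - x0|, of which one truncated difference is always 0. *)
have [k] := ubnP ((x - x0) + (x0 - x)); elim: k x xb => // k IH x xb xk.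
have x0b := subsetP sRb _ x0R.
have step z : z \in R -> z = x.+2 :> nat \/ x = z.+2 :> nat -> x \in R.
  move=> zR [zx|xz]; apply: sR; apply/nb1P.
    have yn : x.+1 < n by have := ltn_ord z; lia.
    exists (Ordinal yn); last by right.
    by apply/nb1P; exists z => //; right.
  have yn : z.+1 < n by have := ltn_ord x; lia.
  exists (Ordinal yn); last by left.
  by apply/nb1P; exists z => //; left.
have := ltn_ord x; have := ltn_ord x0; move: xb x0b; rewrite !inE.
move=> /eqP xb /eqP x0b ltx0 ltx.
have [lt1|lt1|e] := ltngtP x x0; last by rewrite (val_inj e).
- have zn : x.+2 < n by lia.
  apply: (step (Ordinal zn)); last by left.
  by apply: IH; rewrite ?inE /=; lia.
- have zn : x.-2 < n by lia.
  apply: (step (Ordinal zn)); last by right=> /=; lia.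
  by apply: IH; rewrite ?inE /=; lia.
Qed.

(* Points left of the hole x0 are matched with their right neighbours and
   points right of it with their left neighbours. *)
Lemma card_nb1_hole R b (x0 : nat) : R \subset class b -> x0 <= n -> odd x0 = b ->
  {in R, forall x, x != x0 :> nat} -> #|R| <= #|nb1 R|.
Proof.
move=> /subsetP sRb x0n x0b Rx0.
pose f x : 'I_n := if x < x0 then inord x.+1 else inord x.-1.
have fE : {in R, forall x, f x = (if x < x0 then x.+1 else x.-1) :> nat}.
  move=> x xR; have := Rx0 x xR; have := sRb _ xR; rewrite !inE /f => /eqP xb xx0.
  by have := ltn_ord x; case: ifP => h1 h2; rewrite inordK; lia.
have f_inj : {in R &, injective f}.
  move=> x y xR yR /(congr1 (@nat_of_ord _)); rewrite !fE // => fxy.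
  apply: val_inj => /=; have := Rx0 x xR; have := Rx0 y yR.
  have := sRb _ xR; have := sRb _ yR; rewrite !inE => /eqP xb /eqP yb.
  by move: fxy; case: ifP; case: ifP; lia.
rewrite -(card_in_imset f_inj); apply/subset_leq_card/subsetP => y.
case/imsetP => x xR ->; apply/nb1P; exists x => //; rewrite fE //.
have := Rx0 x xR; have := sRb _ xR; rewrite inE => /eqP xb.
by case: ifP; lia.
Qed.

Lemma card_nb1_proper R b : R \subset class b -> R != class b -> #|R| <= #|nb1 R|.
Proof.
move=> sRb; rewrite eqEsubset sRb => /subsetPn[x0]; rewrite inE => /eqP x0b x0R.
apply: (card_nb1_hole sRb (ltnW (ltn_ord x0)) x0b) => x xR.
by apply: contraNneq x0R => /val_inj <-.
Qed.

(* When m is even the odd positions are all interior, so a nonempty set of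
   them has more neighbours than elements. *)
Lemma card_nb1_interior R : ~~ odd m -> R \subset class true -> #|R| <= #|nb1 R|.-1.
Proof.
move=> om /subsetP sR; have [->|/set0Pn[x1 x1R]] := eqVneq R set0.
  by rewrite cards0.
case: (arg_minnP (fun x : 'I_n => x : nat) x1R) => x0 x0R x0min.
have sR1 : {in R, forall x, odd x} by move=> x /sR; rewrite inE => /eqP.
pose f x : 'I_n := inord x.+1.
have fE : {in R, forall x, f x = x.+1 :> nat}.
  by move=> x /sR1 ox; rewrite /f inordK //; have := ltn_ord x; lia.
have f_inj : {in R &, injective f}.
  move=> x y xR yR /(congr1 (@nat_of_ord _)); rewrite !fE // => fxy.
  by apply: val_inj => /=; lia.
suff : f @: R \proper nb1 R.
  by move/proper_card; rewrite card_in_imset // => h; rewrite -ltnS (ltn_predK h).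
apply/properP; split.
  apply/subsetP => _ /imsetP[x xR ->]; apply/nb1P; exists x => //.
  by left; apply: fE.
have x0p := sR1 _ x0R; have x0n : x0.-1 < n by have := ltn_ord x0; lia.
exists (Ordinal x0n); first by apply/nb1P; exists x0 => //; right => /=; lia.
apply/imsetP => -[x xR /(congr1 (@nat_of_ord _))]; rewrite fE //=.
by have := x0min x xR; lia.
Qed.

(** * Stacks of rows, each containing the neighbourhood of the next *)

Section Stack.
Variables (A : nat -> {set 'I_n}) (N : nat) (b : bool).
Hypotheses (m0 : 0 < m)
  (A_class : forall i, i < N -> A i \subset class (b (+) odd i))
  (A_nb1 : forall i, i.+1 < N -> nb1 (A i.+1) \subset A i)
  (A_proper : A 0 != class b).

(** The neighbourhood of a full class is the full opposite class, so a full row would force the row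
    before it to be full, and so on back to [A 0]. *)
Lemma stack_proper i : i < N -> A i != class (b (+) odd i).
Proof.
elim: i => [|i IH] iN; first by rewrite addbF.
apply: contraNneq (IH (ltnW iN)) => Ai; rewrite eqEsubset A_class 1?ltnW //=.
apply: subset_trans (A_nb1 iN); rewrite Ai.
by have := nb1_full (b (+) odd i.+1) m0; rewrite -addbN /= negbK.
Qed.

Lemma stack_step i : i.+2 < N -> #|A i.+2| <= #|A i|.-1.
Proof.
move=> iN; apply: leq_trans (card_nb1_nb1 m0 (A_class iN) (stack_proper iN)) _.
have /subset_leq_card := subset_trans (nb1S (A_nb1 iN)) (A_nb1 (ltnW iN)).
by lia.
Qed.

Lemma stack_bound : 
  2 * \sum_(i < N) #|A i| <= #|A 0| * #|A 0|.+1 + #|A 1| * #|A 1|.+1.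
Proof.
exact: (sum_two_step_bound stack_step).
Qed.

End Stack.

End Path.

(** * Rows of a down-closed set *)

Section Rows.
Variable m : nat.
Local Notation n := m.+1.
Implicit Types (u v : grid n) (S D : {set grid n}).

(** Natural indices allow [i.+1] and [m - i]; an index beyond m is sent to row 0 by [inord]. *)
Definition row S i : {set 'I_n} := [set x : 'I_n | (x, inord i) \in S].

Lemma mem_row S i x : (x \in row S i) = ((x, inord i) \in S).
Proof. by rewrite inE. Qed.

Lemma card_rows S : #|S| = \sum_(i < n) #|row S i|.
Proof.
rewrite (card_fibers snd); apply: eq_bigr => i _.
rewrite -(card_imset _ (f := fun x : 'I_n => (x, i))); last by move=> x y [].
congr #|pred_of_set _|; apply/setP => -[x j]; rewrite !inE /=.
apply/andP/imsetP => [[xS /eqP ji]|[y yS [-> ->]]].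
  by subst j; exists x => //; rewrite mem_row inord_val.
by move: yS; rewrite mem_row inord_val.
Qed.

Lemma row_V1 i : i <= m -> row (V1 n) i = class m (odd i).
Proof.
move=> im; apply/setP => x; rewrite inE V1E inE /= inordK // oddD.
by case: odd; case: odd.
Qed.

Lemma rowD S D i : row (S :\: D) i = row S i :\: row D i.
Proof. by apply/setP => x; rewrite !inE. Qed.

Lemma rowS S D i : S \subset D -> row S i \subset row D i.
Proof. by move=> /subsetP SD; apply/subsetP => x; rewrite !inE; apply: SD. Qed.

Lemma row_opennb S i x : i <= m -> (x \in row (opennb S) i) =
  [|| x \in nb1 (row S i), (i < m) && (x \in row S i.+1)
    | (0 < i) && (x \in row S i.-1)].
Proof.
move=> im; rewrite inE; apply/mem_opennb/or3P => [[[z j] zS]|].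
  have jm := ltn_ord j; rewrite grid_adjE /= inordK // => /orP[]/andP[/eqP h1 h2].
    rewrite -(val_inj h1 : z = x) !inE; case/orP: h2 => /eqP h2.
      by apply: Or32; rewrite -h2 inord_val zS andbT -ltnS.
    by apply: Or33; rewrite h2 /= inord_val.
  apply: Or31; apply/nb1P; exists z; first by rewrite inE -h1 inord_val.
  by case/orP: h2 => /eqP; [right|left].
case.
- move=> /nb1P[z]; rewrite inE => zS zx; exists (z, inord i); rewrite // grid_adjE /=.
  by rewrite eqxx /=; case: zx => ->; rewrite eqxx ?orbT.
- case/andP=> ltim; rewrite inE => xS; exists (x, inord i.+1); rewrite // grid_adjE /=.
  by rewrite !inordK // !eqxx.
- case: i im => // i im /=; rewrite inE => xS; exists (x, inord i);
  rewrite // grid_adjE /=.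
  by rewrite !inordK ?eqxx ?orbT //; lia.
Qed.

Section Closed.
Variable D : {set grid n}.
Hypotheses (m0 : 0 < m) (D_V1 : D \subset V1 n) (D_down : down_closed D).

Lemma row_down i : i < m -> nb1 (row D i.+1) \subset row D i.
Proof.
move=> im; apply/subsetP => x /nb1P[z]; rewrite !inE => zD xz.
by apply: (D_down zD); rewrite //= !inordK //; lia.
Qed.

Lemma row_class i : i <= m -> row D i \subset class m (odd i).
Proof. by move=> im; rewrite -row_V1 // rowS. Qed.

(** Row i + 1 of [opennb D] receives row i of [D], which already contains the sideways neighbours by
    [row_down] and row i + 2 because a set lies in its double neighbourhood. Only [nb1 (row D 0)] is
    added and only row m is lost. *)
Lemma opennb_down_closed :
  #|opennb D| + #|row D m| = #|nb1 (row D 0)| + #|D|.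
Proof.
have row0 : row (opennb D) 0 = nb1 (row D 0).
  apply/setP => x; rewrite row_opennb // orbF; apply/orb_idr => /andP[_].
  by apply: subsetP; apply: subset_trans (sub_nb1_nb1 _ m0) (nb1S (row_down _)).
have rowS i : i < m -> row (opennb D) i.+1 = row D i.
  move=> im; apply/setP => x; rewrite row_opennb //= orbA; apply: orb_idl.
  case/orP => [|/andP[iim]]; first exact: subsetP (row_down im) x.
  apply: subsetP; apply: subset_trans (sub_nb1_nb1 _ m0) _.
  exact: subset_trans (nb1S (row_down _)) (row_down im).
rewrite (card_rows (opennb D)) (card_rows D) big_ord_recl big_ord_recr /= row0 addnA.
by congr (_ + _ + _); apply: eq_bigr => i _; rewrite /bump /= add1n rowS.
Qed.

(** Below a point [x] of row m lies a full cone: j rows down it covers every position of the right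
    parity within distance j, and j = m suffices for the whole class. *)
Lemma row_top_nonempty : row D m != set0 -> row D 0 = class m false.
Proof.
case/set0Pn=> x xD; apply/eqP; rewrite eqEsubset (row_class (leq0n m)) /=.
suff H j : j <= m -> forall y : 'I_n, (y - x) + (x - y) <= j ->
    odd y = odd (x + j) -> y \in row D (m - j).
  have xm := subsetP (row_class (leqnn m)) _ xD; rewrite inE in xm.
  apply/subsetP => y; rewrite inE -(subnn m) => /eqP yo; apply: H => //.
    by have := ltn_ord x; have := ltn_ord y; lia.
  by rewrite yo oddD (eqP xm) addbb.
elim: j => [_ y xy _|j IH jm y yx yo].
  by rewrite subn0 (_ : y = x) //; apply: val_inj => /=; lia.
have jm' : m - j.+1 < m by lia.
apply: (subsetP (row_down jm')).
have -> : (m - j.+1).+1 = m - j by lia.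
have ltx := ltn_ord x; have lty := ltn_ord y.
have [lt1|lt1|e] := ltngtP y x.
- have zn : y.+1 < n by lia.
  apply/nb1P; exists (Ordinal zn); last by right.
  by apply: IH => /=; lia.
- have zn : y.-1 < n by lia.
  apply/nb1P; exists (Ordinal zn); last by left => /=; lia.
  by apply: IH => /=; lia.
(* For y = x the parity condition makes j odd, so a neighbour at distance 1 is still within
   reach. *)
- have [z yz] := exists_nb y m0; apply/nb1P; exists z => //.
  by apply: IH; move: yz => [yz|yz]; lia.
Qed.

(** Let t be the size of [nb1 (row D 0)]. Row 0 has at most t points and row 1 at most t - 1, both
    being proper in their classes, so [stack_bound] gives 2|D| <= t(t + 1) + (t - 1)t. *)
Lemma card_down_closed : row D 0 != class m false -> #|D| <= #|nb1 (row D 0)| ^ 2.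
Proof.
move=> D0.
have rc i : i < n -> row D i \subset class m (false (+) odd i) by apply: row_class.
have B := stack_bound m0 rc row_down D0.
have P := stack_proper m0 rc row_down D0.
have h0 := card_nb1_proper (rc _ (ltn0Sn m)) D0.
have h1 := card_nb1_nb1 m0 (rc 1 m0) (P 1 m0).
have h2 := subset_leq_card (nb1S (row_down m0)).
rewrite -card_rows in B; move: B h0 h1 h2.
move: #|D| #|row D 0| #|row D 1| #|nb1 (row D 0)| #|nb1 (nb1 _)| => d a b t tt.
move=> d2 at_ bt tt_; have {tt_}bt : b <= t.-1 by lia.
have := leq_mul at_ (at_ : a.+1 <= t.+1); have := leq_mul bt (bt : b.+1 <= t.-1.+1).
by case: t {at_ bt} => [|t] /=; lia.
Qed.

(** The complement of a down-closed set is closed upwards, so its rows read from the top form a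
    stack as well. *)
Let C i := row (V1 n :\: D) (m - i).

Lemma costack_class i : i < n -> C i \subset class m (odd m (+) odd i).
Proof.
by rewrite ltnS => im; rewrite /C rowD row_V1 ?leq_subr // oddB // subsetDl.
Qed.

Lemma costack_nb1 i : i.+1 < n -> nb1 (C i.+1) \subset C i.
Proof.
rewrite ltnS => im; apply/subsetP => x xC.
rewrite /C rowD row_V1 ?leq_subr //; apply/setDP; split.
  have := subsetP (nb1_class (@costack_class i.+1 im)) _ xC.
  by rewrite oddB 1?ltnW //= addbN negbK.
case/nb1P: xC => z; rewrite /C rowD => /setDP[_ zD] xz.
apply: contra zD => xD; apply: (subsetP (row_down _)); first by lia.
apply/nb1P; exists x; last by case: xz; [right|left].
by rewrite (_ : (m - i.+1).+1 = m - i) //; lia.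
Qed.

(** The parity of m decides whether the class of [C 1] contains an end of the path. For odd m it
    contains 0 and [C 1] has at most k points; for even m it is interior and [C 1] has at most k -
    1. [stack_bound] turns this into the two bounds. *)
Lemma card_codown_closed k :
  row D m != set0 -> #|class m (odd m) :\: row D m| = k ->
  #|V1 n :\: D| <= if odd m then k * k.+1 else k ^ 2.
Proof.
move=> Dm kE; have C0 : C 0 = class m (odd m) :\: row D m.
  by rewrite /C subn0 rowD row_V1.
have Cp : C 0 != class m (odd m).
  apply: contra Dm; rewrite C0 => /eqP e; rewrite -subset0; apply/subsetP => x xD.
  have := subsetP (row_class (leqnn m)) _ xD; rewrite -e in_setD xD.
  by [].
have c1 : C 1 \subset class m (~~ odd m).
  by have := @costack_class 1 m0; rewrite addbT.
have B := stack_bound m0 costack_class costack_nb1 Cp.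
have -> : #|V1 n :\: D| = \sum_(i < n) #|C i|.
  by rewrite card_rows (reindex_inj rev_ord_inj); apply: eq_bigr => i _;
    rewrite /C /= subSS.
have := subset_leq_card (@costack_nb1 0 m0).
rewrite C0 kE in B *; move: B; case: ifP => om.
  have C1 : #|C 1| <= #|nb1 (C 1)|.
    (* The hole is the virtual position n just past the path, so every point is matched with its
       right neighbour. *)
    apply: (card_nb1_hole c1 (leqnn n)) => [|x _]; first by rewrite /= om.
    by have := ltn_ord x; lia.
  move: #|C 1| #|nb1 _| C1 => a b ? B ?; have ak : a <= k by lia.
  by have := leq_mul ak (ak : a.+1 <= k.+1); lia.
have C1 : #|C 1| <= #|nb1 (C 1)|.-1.
  by rewrite om in c1; apply: card_nb1_interior; rewrite ?om.
move: #|C 1| #|nb1 _| C1 => a b ab B bk; have ak : a <= k.-1 by lia.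
have := leq_mul ak (ak : a.+1 <= k.-1.+1).
by case: k B {ak kE bk} => [|k] /=; lia.
Qed.

End Closed.
End Rows.

(** * The orderings of V_1 *)

Section Listing.
Variables (T : finType) (r : rel T) (s : seq T) (p : nat).
Hypotheses (r_asym : forall u v, r u v -> ~~ r v u) (s_r : pairwise r s).

Lemma card_take_set : p <= size s -> #|[set v in take p s]| = p.
Proof.
move=> ps; rewrite cardsE; have r_irr : irreflexive r.
  by move=> v; apply/negP => rvv; have := r_asym rvv; rewrite rvv.
rewrite (card_uniqP _) ?size_takel // take_uniq //.
exact: pairwise_uniq r_irr s_r.
Qed.

Lemma take_set_lower u v :
  v \in [set v in take p s] -> u \in s -> r u v -> u \in [set v in take p s].
Proof.
rewrite !inE => vp; rewrite -{1}(cat_take_drop p s) mem_cat => /orP[//|ud] ruv.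
have := s_r; rewrite -{1}(cat_take_drop p s) pairwise_cat => /and3P[/allrelP h _ _].
by have := h _ _ vp ud; rewrite (negPf (r_asym ruv)).
Qed.

End Listing.

Section Orders.
Variable m : nat.
Local Notation n := m.+1.
Implicit Types (u v : grid n) (S : {set grid n}).

Lemma pairwise_by_y S : {in S &, injective (@yc n)} ->
  pairwise (fun u v => yc u < yc v) (by_y S).
Proof.
move=> yinj; have le_tr : transitive (fun u v : grid n => yc u <= yc v).
  by move=> ? ? ?; apply: leq_trans.
have : pairwise (fun u v : grid n => yc u <= yc v) (by_y S).
  by rewrite -sorted_pairwise // sort_sorted // => u v; apply: leq_total.
have : uniq (by_y S) by rewrite sort_uniq enum_uniq.
rewrite uniq_pairwise => h1 h2.
have : pairwise (fun u v => (u != v) && (yc u <= yc v)) (by_y S).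
  by rewrite pairwise_relI h2 andbT.
apply: (sub_in_pairwise (P := mem S)).
  move=> u v uS vS /= /andP[uv]; rewrite ltn_neqAle => ->; rewrite andbT.
  by apply: contra uv => /eqP /(yinj _ _ uS vS) ->.
by apply/allP => v; rewrite mem_sort mem_enum.
Qed.

Lemma pairwise_flatten_by_y (g : nat -> {set grid n}) (r : rel (grid n)) a l :
  (forall k, {in g k &, injective (@yc n)}) ->
  (forall k, {in g k &, forall u v, yc u < yc v -> r u v}) ->
  (forall k k' u v, k < k' -> u \in g k -> v \in g k' -> r u v) ->
  pairwise r (flatten [seq by_y (g k) | k <- iota a l]).
Proof.
move=> yinj rin rout; elim: l a => // l IH a /=.
rewrite pairwise_cat IH andbT; apply/andP; split.
  apply/allrelP => u v; rewrite mem_sort mem_enum => ua /flattenP[_ /mapP[k + ->]].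
  rewrite mem_iota mem_sort mem_enum => /andP[ak _].
  exact: rout ua.
apply: sub_in_pairwise (pairwise_by_y (yinj a)) => [u v|].
  exact: (rin a u v).
by apply/allP => v; rewrite mem_sort mem_enum.
Qed.

Definition ltU u v := (u.1 + u.2 < v.1 + v.2)
  || (u.1 + u.2 == v.1 + v.2 :> nat) && (u.2 < v.2).

(** Decreasing x - y, then increasing y, with terms moved across to avoid truncated subtraction. *)
Definition ltW u v := (v.1 + u.2 < u.1 + v.2)
  || (v.1 + u.2 == u.1 + v.2 :> nat) && (u.2 < v.2).

Lemma ltU_asym u v : ltU u v -> ~~ ltU v u.
Proof.
case: u v => [[x hx] [y hy]] [[x' hx'] [y' hy']]; rewrite /ltU /=; lia.
Qed.

Lemma ltW_asym u v : ltW u v -> ~~ ltW v u.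
Proof.
case: u v => [[x hx] [y hy]] [[x' hx'] [y' hy']]; rewrite /ltW /=; lia.
Qed.

Lemma mem_order_U v : (v \in order_U n) = (v \in V1 n).
Proof.
apply/flattenP/idP => [[_ /mapP[k _ ->]]|].
  by rewrite mem_sort mem_enum !inE => /eqP ->; rewrite mul2n odd_double.
rewrite inE => v_even; exists (by_y (U n (2 * (xc v + yc v)./2))).
  apply/mapP; exists (xc v + yc v)./2 => //; rewrite mem_iota.
  by have := ltn_ord v.1; have := ltn_ord v.2; rewrite /xc /yc; lia.
by rewrite mem_sort mem_enum inE; lia.
Qed.

Lemma pairwise_order_U : pairwise ltU (order_U n).
Proof.
apply: (pairwise_flatten_by_y (g := fun k => U n (2 * k))).
- move=> k [[x hx] [y hy]] [[x' hx'] [y' hy']]; rewrite !inE /xc /yc /= => h1 h2 h3.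
  by apply/eqP/gridP => /=; lia.
- move=> k [[x hx] [y hy]] [[x' hx'] [y' hy']]; rewrite !inE /xc /yc /ltU /= => h1 h2.
  by lia.
- move=> k k' [[x hx] [y hy]] [[x' hx'] [y' hy']] kk; rewrite !inE /xc /yc /ltU /=.
  by lia.
Qed.

Lemma mem_order_W v : (v \in order_W n) = (v \in V1 n).
Proof.
case: v => [[x hx] [y hy]]; apply/flattenP/idP => [[_ /mapP[k _ ->]]|].
  by rewrite mem_sort mem_enum !inE /xc /yc /=; lia.
rewrite inE /xc /yc /= => v_even.
(* This is k = c - 1 - (x - y)/2 with c = [uphalf n]; one of the two truncated differences is 0. *)
pose k := uphalf n + uphalf (y - x) - (x - y)./2 - 1.
exists (by_y (W n (Posz (2 * uphalf n)%N - Posz 2 - Posz (2 * k)%N)%R)).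
  apply/mapP; exists k => //; rewrite mem_iota /k.
  by lia.
by rewrite mem_sort mem_enum inE /xc /yc /= /k; lia.
Qed.

Lemma pairwise_order_W : pairwise ltW (order_W n).
Proof.
apply: (pairwise_flatten_by_y
  (g := fun k => W n (Posz (2 * uphalf n)%N - Posz 2 - Posz (2 * k)%N)%R)).
- move=> k [[x hx] [y hy]] [[x' hx'] [y' hy']]; rewrite !inE /xc /yc /= => h1 h2 h3.
  by apply/eqP/gridP => /=; lia.
- move=> k [[x hx] [y hy]] [[x' hx'] [y' hy']]; rewrite !inE /xc /yc /ltW /= => h1 h2.
  by lia.
- move=> k k' [[x hx] [y hy]] [[x' hx'] [y' hy']] kk; rewrite !inE /xc /yc /ltW /=.
  by lia.
Qed.

(** * Initial segments of V_1 *)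

Definition lower (r : rel (grid n)) S :=
  forall u v, v \in S -> u \in V1 n -> r u v -> u \in S.

Lemma Z_lower p : lower ltU (Z n p).
Proof.
move=> u v vZ uV ruv; apply: take_set_lower vZ _ ruv => //.
- exact: ltU_asym.
- exact: pairwise_order_U.
- by rewrite mem_order_U.
Qed.

Lemma Z'_lower p : lower ltW (Z' n p).
Proof.
move=> u v vZ uV ruv; apply: take_set_lower vZ _ ruv => //.
- exact: ltW_asym.
- exact: pairwise_order_W.
- by rewrite mem_order_W.
Qed.

Lemma Z_V1 p : Z n p \subset V1 n.
Proof. by apply/subsetP => v; rewrite inE => /mem_take; rewrite mem_order_U. Qed.

Lemma Z'_V1 p : Z' n p \subset V1 n.
Proof. by apply/subsetP => v; rewrite inE => /mem_take; rewrite mem_order_W. Qed.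

Lemma card_Z p : p <= #|V1 n| -> #|Z n p| = p.
Proof.
move=> pV; apply: (card_take_set ltU_asym pairwise_order_U).
apply: leq_trans pV _; rewrite -(eq_card mem_order_U); exact: card_size.
Qed.

Lemma card_Z' p : p <= #|V1 n| -> #|Z' n p| = p.
Proof.
move=> pV; apply: (card_take_set ltW_asym pairwise_order_W).
apply: leq_trans pV _; rewrite -(eq_card mem_order_W); exact: card_size.
Qed.

Lemma lower_down_closed (r : rel (grid n)) S : S \subset V1 n -> lower r S ->
  (forall u v, v.2 = u.2.+1 :> nat ->
     u.1 = v.1.+1 :> nat \/ v.1 = u.1.+1 :> nat -> r u v) ->
  down_closed S.
Proof.
move=> /subsetP SV Sr rdown u v vS vu2 vu1; apply: (Sr u v vS); last exact: rdown.
by move: (SV _ vS); rewrite !V1E vu2; case: vu1 => ->; lia.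
Qed.

(** A diagonal step down stays on the same antidiagonal, where the tie-break by y applies, or
    reaches an earlier one. *)
Lemma ltU_down u v : v.2 = u.2.+1 :> nat ->
  u.1 = v.1.+1 :> nat \/ v.1 = u.1.+1 :> nat -> ltU u v.
Proof.
case: u v => [[x hx] [y hy]] [[x' hx'] [y' hy']]; rewrite /ltU /=; lia.
Qed.

Lemma ltW_down u v : v.2 = u.2.+1 :> nat ->
  u.1 = v.1.+1 :> nat \/ v.1 = u.1.+1 :> nat -> ltW u v.
Proof.
case: u v => [[x hx] [y hy]] [[x' hx'] [y' hy']]; rewrite /ltW /=; lia.
Qed.

(* The points at which max a b takes a given value w fill one antidiagonal
   x + y = 2 w, of 2 w + 1 points. *)
Lemma corner_lt S v j : v \in S -> v.2 = 0 :> nat -> v.1 = 2 * j :> nat ->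
  lower ltU S -> j ^ 2 < #|S|.
Proof.
move=> vS v2 v1 Sr; have -> : j ^ 2 = #|{: 'I_j * 'I_j}|
  by rewrite card_prod !card_ord mulnn.
have jm : 2 * j <= m by rewrite -v1 -ltnS ltn_ord.
pose f (ab : 'I_j * 'I_j) : grid n :=
  (inord (maxn ab.1 ab.2 + ab.1 - ab.2), inord (maxn ab.1 ab.2 + ab.2 - ab.1)).
have fE ab : ((f ab).1 = maxn ab.1 ab.2 + ab.1 - ab.2 :> nat) *
             ((f ab).2 = maxn ab.1 ab.2 + ab.2 - ab.1 :> nat).
  by case: ab => [[a ha] [b hb]]; rewrite /f /= !inordK //; lia.
have flt ab : (f ab).1 + (f ab).2 < 2 * j.
  by rewrite !fE; case: ab => [[a ha] [b hb]] /=; lia.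
apply: (card_inj_lt (f := f) (v := v)) => //.
- move=> [[a ha] [b hb]] [[a' ha'] [b' hb']] e.
  have := congr1 (fun v : grid n => v.1 : nat) e.
  have := congr1 (fun v : grid n => v.2 : nat) e.
  by rewrite !fE /= => e1 e2; congr (_, _); apply: val_inj => /=; lia.
- move=> ab; apply: (Sr _ v) => //; last by rewrite /ltU v1 v2 addn0 flt.
  by rewrite V1E !fE; case: ab => [[a ha] [b hb]] /=; lia.
- move=> ab; apply/gridP; rewrite v1 v2 => -[e1 e2].
  by have := flt ab; rewrite e1 e2; lia.
Qed.

(** The injection of [corner_lt] after a half-turn of the grid: it fills antidiagonals from the
    corner (m, m), all listed after [v] and hence outside [S]. *)
Lemma corner_gt S v j : ~~ odd m -> v \in V1 n :\: S -> v.2 = m :> nat ->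
  2 * j <= m -> v.1 = m - 2 * j :> nat -> lower ltU S -> j ^ 2 < #|V1 n :\: S|.
Proof.
move=> om vS v2 jm v1 Sr; have -> : j ^ 2 = #|{: 'I_j * 'I_j}|
  by rewrite card_prod !card_ord mulnn.
pose f (ab : 'I_j * 'I_j) : grid n :=
  (inord (m - (maxn ab.1 ab.2 + ab.1 - ab.2)),
   inord (m - (maxn ab.1 ab.2 + ab.2 - ab.1))).
have fE ab : ((f ab).1 = m - (maxn ab.1 ab.2 + ab.1 - ab.2) :> nat) *
             ((f ab).2 = m - (maxn ab.1 ab.2 + ab.2 - ab.1) :> nat).
  by rewrite /f /= !inordK // ltnS leq_subr.
have flt ab : v.1 + v.2 < (f ab).1 + (f ab).2.
  by rewrite !fE v1 v2; case: ab => [[a ha] [b hb]] /=; lia.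
have [vV vnS] := setDP vS.
apply: (card_inj_lt (f := f) (v := v)) => //.
- move=> [[a ha] [b hb]] [[a' ha'] [b' hb']] e.
  have := congr1 (fun v : grid n => v.1 : nat) e.
  have := congr1 (fun v : grid n => v.2 : nat) e.
  by rewrite !fE /= => e1 e2; congr (_, _); apply: val_inj => /=; lia.
- move=> ab; apply/setDP; split.
    by rewrite V1E !fE; case: ab => [[a ha] [b hb]] /=; lia.
  by apply: contra vnS => fS; apply: (Sr _ (f ab)) => //; rewrite /ltU flt.
- move=> ab; apply/gridP => -[e1 e2].
  by have := flt ab; rewrite e1 e2 ltnn.
Qed.

(* The points at which w = max (a + 1) b takes a given value fill the diagonal
   x - y = 2 w - n, of 2 w points. *)
Lemma corner_W S v j : odd m -> v \in V1 n :\: S -> v.2 = m :> nat ->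
  v.1 = (2 * j).+1 :> nat -> lower ltW S -> j * j.+1 < #|V1 n :\: S|.
Proof.
move=> om vS v2 v1 Sr; have -> : j * j.+1 = #|{: 'I_j * 'I_j.+1}|
  by rewrite card_prod !card_ord.
have jm : (2 * j).+1 <= m by rewrite -v1 -ltnS ltn_ord.
pose X (a b : nat) := if b <= a then b else b + a.
pose f (ab : 'I_j * 'I_j.+1) : grid n :=
  (inord (X ab.1 ab.2), inord (X ab.1 ab.2 + n - 2 * maxn ab.1.+1 ab.2)).
have fE ab : ((f ab).1 = X ab.1 ab.2 :> nat) *
             ((f ab).2 = X ab.1 ab.2 + n - 2 * maxn ab.1.+1 ab.2 :> nat).
  case: ab => [[a ha] [b hb]]; rewrite /f /X /=.
  by case: ifP => ab; rewrite !inordK //; lia.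
have flt ab : (f ab).1 + v.2 < v.1 + (f ab).2.
  by rewrite !fE v2 v1 /X; case: ab => [[a ha] [b hb]] /=; case: ifP; lia.
have [vV vnS] := setDP vS.
apply: (card_inj_lt (f := f) (v := v)) => //.
- move=> [[a ha] [b hb]] [[a' ha'] [b' hb']] e.
  have := congr1 (fun v : grid n => v.1 : nat) e.
  have := congr1 (fun v : grid n => v.2 : nat) e.
  rewrite !fE /= /X; do 2 case: ifP => ?; move=> e1 e2;
  by congr (_, _); apply: val_inj => /=; lia.
- move=> ab; apply/setDP; split.
    by rewrite V1E !fE /X; case: ab => [[a ha] [b hb]] /=; case: ifP; lia.
  by apply: contra vnS => fS; apply: (Sr _ (f ab)) => //; rewrite /ltW flt.
- move=> ab; apply/gridP => -[e1 e2].
  by have := flt ab; rewrite e1 e2 ltnn.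
Qed.

(** By [corner_lt], row 0 of [S] has only even positions below 2t, whose neighbours are odd
    positions below 2t; halving numbers these. *)
Lemma nb1_row_lower S t : S \subset V1 n -> lower ltU S ->
  #|S| <= t ^ 2 -> #|nb1 (row S 0)| <= t.
Proof.
move=> SV Sr St.
have rowS x : x \in row S 0 -> odd x = false /\ x < 2 * t.
  move=> xS; have := subsetP (row_class SV (leq0n m)) _ xS.
  rewrite inE => /eqP xe; split=> //; rewrite mem_row in xS.
  have h : x = 2 * x./2 :> nat by lia.
  have := corner_lt xS (inordK (ltn0Sn m)) h Sr.
  by move=> /leq_trans/(_ St); rewrite ltn_sqr; lia.
apply: (card_leq_bound (f := fun x : 'I_n => x./2)) => [x y|x].
  move=> /nb1P[z /rowS[zo _] xz] /nb1P[w /rowS[wo _] yw] e.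
  by apply: val_inj => /=; lia.
by move=> /nb1P[z /rowS[zo zt] xz]; lia.
Qed.

(** The order [ltU] ends at the corner (m, m), so the missing points of row m are numbered from its
    right end; [corner_gt] keeps the numbers below k. *)
Lemma row_top_ltU S k : ~~ odd m -> lower ltU S ->
  #|V1 n :\: S| <= k ^ 2 -> #|class m (odd m) :\: row S m| <= k.
Proof.
move=> om Sr Sk; apply: (card_leq_bound (f := fun x : 'I_n => (m - x)./2)) => [x y|x].
  rewrite !inE => /andP[_ /eqP xo] /andP[_ /eqP yo] e.
  by apply: val_inj => /=; have := ltn_ord x; have := ltn_ord y; lia.
rewrite -row_V1 // -rowD mem_row => xS.
have xo : odd x = odd m.
  by move: xS; rewrite in_setD V1E /= inordK // => /andP[_]; lia.
have jm : 2 * (m - x)./2 <= m by have := ltn_ord x; lia.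
have h : x = m - 2 * (m - x)./2 :> nat by have := ltn_ord x; lia.
have := corner_gt om xS (inordK (ltnSn m)) jm h Sr.
by move=> /leq_trans/(_ Sk); rewrite ltn_sqr.
Qed.

(** The order [ltW] ends near the corner (0, m), so here the missing points are numbered from the
    left end, with [corner_W] as the bound. *)
Lemma row_top_ltW S k : odd m -> lower ltW S ->
  #|V1 n :\: S| <= k * k.+1 -> #|class m (odd m) :\: row S m| <= k.
Proof.
move=> om Sr Sk; apply: (card_leq_bound (f := fun x : 'I_n => x./2)) => [x y|x].
  rewrite !inE => /andP[_ /eqP xo] /andP[_ /eqP yo] e.
  by apply: val_inj => /=; lia.
rewrite -row_V1 // -rowD mem_row => xS.
have xo : odd x = odd m.
  by move: xS; rewrite in_setD V1E /= inordK // => /andP[_]; lia.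
have h : x = (2 * x./2).+1 :> nat by lia.
have := corner_W om xS (inordK (ltnSn m)) h Sr.
by move=> /leq_trans/(_ Sk); nia.
Qed.

(** * Comparison of down-closed sets by their extreme rows *)

Lemma opennb_leq (D E : {set grid n}) : 0 < m ->
  D \subset V1 n -> E \subset V1 n -> down_closed D -> down_closed E ->
  #|D| = #|E| -> #|nb1 (row E 0)| <= #|nb1 (row D 0)| ->
  #|class m (odd m) :\: row E m| <= #|class m (odd m) :\: row D m| ->
  #|opennb E| <= #|opennb D|.
Proof.
move=> m0 DV EV Dd Ed DE h0 hm.
have := opennb_down_closed m0 DV Dd; have := opennb_down_closed m0 EV Ed.
move: hm; rewrite !cardsDS ?row_class //.
have := subset_leq_card (row_class EV (leqnn m)).
have := subset_leq_card (row_class DV (leqnn m)).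
by lia.
Qed.

Lemma opennb_min (D : {set grid n}) : 0 < m -> D \subset V1 n -> down_closed D ->
  minn #|opennb (Z n #|D|)| #|opennb (Z' n #|D|)| <= #|opennb D|.
Proof.
move=> m0 DV Dd; set p := #|D|; have pV : p <= #|V1 n| := subset_leq_card DV.
have ZV := Z_V1 p; have Zl := @Z_lower p; have cZ := card_Z pV.
have Z'V := Z'_V1 p; have Z'l := @Z'_lower p; have cZ' := card_Z' pV.
have Zd := lower_down_closed ZV Zl ltU_down.
have Z'd := lower_down_closed Z'V Z'l ltW_down.
have [D0|D0] := eqVneq (row D 0) (class m false); last first.
  have Dm : row D m = set0.
    by apply/eqP; apply: contraNT D0 => /(row_top_nonempty m0 DV Dd) ->.
  rewrite geq_min opennb_leq //.
    by apply: nb1_row_lower; rewrite ?cZ //; apply: card_down_closed.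
  by rewrite Dm setD0 subset_leq_card ?subsetDl.
have nbD (E : {set grid n}) : E \subset V1 n -> #|nb1 (row E 0)| <= #|nb1 (row D 0)|.
  by move=> EV; rewrite D0; apply/subset_leq_card/nb1S/row_class.
(* With row 0 of [D] full and row m empty, [D] is extreme in both comparisons, so any competitor
   does. *)
have [Dm|Dm] := eqVneq (row D m) set0.
  by rewrite geq_min opennb_leq ?nbD // Dm setD0 subset_leq_card ?subsetDl.
have := card_codown_closed m0 DV Dd Dm erefl; set k := #|_ :\: row D m|.
have coE (E : {set grid n}) : E \subset V1 n -> #|E| = p -> #|V1 n :\: E| = #|V1 n :\: D|.
  by move=> EV cE; rewrite !cardsDS // cE.
rewrite geq_min; case: ifP => om hk; apply/orP; [right|left].
  by apply: opennb_leq; rewrite ?nbD //; apply: row_top_ltW; rewrite ?coE.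
by apply: opennb_leq; rewrite ?nbD //; apply: row_top_ltU; rewrite ?coE // om.
Qed.

End Orders.

Theorem theorem9 (n : nat) (Q : {set grid n}) :
  Q \subset V1 n ->
  minn (delta (@grid_adj n) (Z n #|Q|)) (delta (@grid_adj n) (Z' n #|Q|))
    <= delta (@grid_adj n) Q.
Proof.
(* The cases n = 0 and n = 1 are separate: the row arguments need every point of the path to have a
   neighbour. *)
case: n Q => [|[|m]] Q QV.
- by rewrite geq_min /delta eq_card0 // => -[[]].
- rewrite geq_min; apply/orP; left; apply: leq_trans (delta_leq_opennb _) _.
  rewrite (_ : opennb _ = set0) ?cards0 //; apply/eqP; rewrite -subset0.
  apply/subsetP => v /mem_opennb[u _]; rewrite grid_adjE.
  by case: u v => [[[|x] hx] [[|y] hy]] [[[|x'] hx'] [[|y'] hy']].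
have [D [DV DQ Dnb Dd]] := exists_down_closed QV.
rewrite (delta_opennb QV) -DQ; apply: leq_trans Dnb.
apply: leq_trans (opennb_min _ DV Dd) => //.
by rewrite leq_min !geq_min !delta_leq_opennb orbT.
Qed.
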